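(* Let $K$ be a suitable convolution kernel on $\mathbb{R}^d$, let $E_0\subseteq\Omega\subseteq\mathbb{R}^d$ be measurable with $P_K(E_0)<\infty$, write $E_1:=T_KE_0$, and suppose that $\Omega\supseteq E_1\cup E_0$. Then $|E_1\setminus E_0|=0$ if and only if for all measurable $F\subseteq\Omega\setminus E_0$ $$P_K(E_0\cup F)+\mathcal{S}_K(F)\ge P_K(E_0).$$
   Context: A suitable convolution kernel is a function $K:\mathbb{R}^d\to\mathbb{R}$ with $K\ge 0$, $K(-x)=K(x)$, and $\int_{\mathbb{R}^d}K\,dx=1$. For measurable $D\subseteq\mathbb{R}^d$: $P_K(D):=\int_{D^c}K*\chi_D\,dx\in[0,\infty]$ (the $K$-perimeter), $\mathcal{S}_K(D):=\int_DK*\chi_D\,dx\in[0,\infty]$ (the self-interaction), and $T_KD:=\{x\in\mathbb{R}^d:(K*\chi_D)(x)>1/2\}$. $|\cdot|$ is Lebesgue measure. *)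

(* Defs.v *)
From HB Require Import structures.
From mathcomp Require Import all_boot all_order all_algebra.
From mathcomp Require Import all_classical all_reals all_analysis.

Set Implicit Arguments.
Unset Strict Implicit.
Unset Printing Implicit Defensive.

Import Order.TTheory GRing.Theory Num.Theory.
Import numFieldNormedType.Exports.

Local Open Scope classical_set_scope.
Local Open Scope ring_scope.
Local Open Scope ereal_scope.

Section lebesgue_outer_measure.
Context (R : realType) (n : nat).
Local Notation vec := 'rV[R]_n.+1.

Definition box (ab : vec * vec) : set vec :=
  [set x | forall i, (ab.1 ord0 i < x ord0 i <= ab.2 ord0 i)%R].

(* The maximum makes the volume vanish when the box is empty. *)
Definition box_volume (ab : vec * vec) : R :=
  (\prod_(i < n.+1) Num.max 0 (ab.2 ord0 i - ab.1 ord0 i))%R.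

Definition box_cover (A : set vec) : set (vec * vec)^nat :=
  [set B | A `<=` \bigcup_k box (B k)].

Definition lebesgue_outer (A : set vec) : \bar R :=
  ereal_inf [set \sum_(k <oo) (box_volume (B k))%:E | B in box_cover A].

Lemma box_volume_ge0 ab : 0 <= (box_volume ab)%:E.
Proof. by rewrite lee_fin prodr_ge0// => i _; rewrite le_max lexx. Qed.

Lemma lebesgue_outer_ge0 A : 0 <= lebesgue_outer A.
Proof.
apply: le_ereal_inf_tmp => _ [B _ <-].
by apply: nneseries_ge0 => k _ _; exact: box_volume_ge0.
Qed.

Lemma lebesgue_outer0 : lebesgue_outer set0 = 0.
Proof.
apply/eqP; rewrite eq_le lebesgue_outer_ge0 andbT.
apply: ereal_inf_lbound; exists (fun=> (0%R, 0%R)); first by move=> x [].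
apply: eseries0 => k _ _.
by rewrite /box_volume big_ord_recl/= subrr maxxx mul0r.
Qed.

Lemma le_lebesgue_outer : {homo lebesgue_outer : A B / A `<=` B >-> A <= B}.
Proof.
move=> A B AB; apply/ereal_inf_le_tmp => _ [C BC <-].
by exists C => //; exact: subset_trans AB BC.
Qed.

Lemma lebesgue_outer_sigma_subadditive : sigma_subadditive lebesgue_outer.
Proof.
move=> A; have [[i ioo]|] := pselect (exists i, lebesgue_outer (A i) = +oo).
  rewrite (eseries_pinfty _ _ ioo) ?leey// => k _.
  by rewrite -ltNye (lt_le_trans _ (lebesgue_outer_ge0 _)).
rewrite -forallNE => Aoo.
suff add2e (e : {posnum R}) :
    lebesgue_outer (\bigcup_n A n)
    <= \sum_(i <oo) lebesgue_outer (A i) + e%:num%:E.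
  by apply/lee_addgt0Pr => _/posnumP[].
rewrite (le_trans _ (epsilon_trick _ _ _))//; last first.
  by move=> k; exact: lebesgue_outer_ge0.
pose P k (B : (vec * vec)^nat) := box_cover (A k) B /\
  \sum_(j <oo) (box_volume (B j))%:E
  <= lebesgue_outer (A k) + (e%:num / (2 ^ k.+1)%:R)%:E.
have [G PG] : {G : ((vec * vec)^nat)^nat & forall k, P k (G k)}.
  apply: (@choice _ _ P) => k; rewrite /P.
  have fA : lebesgue_outer (A k) \is a fin_num.
    by rewrite ge0_fin_numE ?lebesgue_outer_ge0// ltey; exact/eqP/Aoo.
  have ek : (0 < e%:num / (2 ^ k.+1)%:R)%R by [].
  have [_ [B AB <-] /ltW lB] := lb_ereal_inf_adherent ek fA.
  by exists B.
pose v (p : nat * nat) := (box_volume (G p.1 p.2))%:E.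
have v_ge0 p : 0 <= v p by exact: box_volume_ge0.
apply: (@le_trans _ _ (\esum_(i in setT) v i)).
  apply: ereal_inf_lbound => /=.
  have /card_esym/ppcard_eqP[f] := card_nat2.
  exists (fun k => G (f k).1 (f k).2).
    move=> t [i _] /((PG i).1 t)[j _ Bijt]; exists (f^-1%FUN (i, j)) => //=.
    by rewrite invK ?inE.
  rewrite -(esum_pred_image v f xpredT)//=; last first.
    by rewrite [fun=> _]set_true.
  by congr esum; rewrite [fun=> _]set_true image_eq.
rewrite (_ : esum _ _ = \sum_(i <oo) \sum_(j <oo) v (i, j)); last first.
  pose J : nat -> set (nat * nat) := fun i => [set (i, j) | j in setT].
  rewrite (_ : setT = \bigcup_k J k); last first.
    by rewrite predeqE => -[a b]; split => // _; exists a => //; exists b.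
  rewrite esum_bigcupT /=; last 2 first.
    - apply/trivIsetP => i j _ _ ij.
      rewrite predeqE => -[k m] /=; split => //= -[] [_] _ [<-{k} _].
      by move=> [m' _] [] /esym/eqP; rewrite (negbTE ij).
    - by move=> p; exact: v_ge0.
  rewrite -(image_id [set: nat]) -fun_true esum_pred_image//; last first.
    by move=> k _; exact: esum_ge0.
  apply: eq_eseriesr => /= j _.
  rewrite -(esum_pred_image v (pair j) predT)//=; last first.
    by move=> ? ? _ _; exact: (@can_inj _ _ _ snd).
  by congr esum; rewrite predeqE => -[a b]; split; move=> [i _ <-]; exists i.
apply: lee_nneseries => [k _ _|k _]; first by exact: nneseries_ge0.
exact: (PG k).2.
Qed.

HB.instance Definition _ := isOuterMeasure.Build R vec lebesgue_outer
  lebesgue_outer0 lebesgue_outer_ge0 le_lebesgue_outer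
  lebesgue_outer_sigma_subadditive.

End lebesgue_outer_measure.

(* R^(n+1) equipped with the complete sigma-algebra of Lebesgue measurable
   sets, i.e. the sets satisfying Caratheodory's criterion for
   lebesgue_outer. *)
Definition euclidean (R : realType) (n : nat) : Type :=
  caratheodory_type (@lebesgue_outer R n).

HB.instance Definition _ (R : realType) (n : nat) :=
  Measurable.on (euclidean R n).
HB.instance Definition _ (R : realType) (n : nat) :=
  GRing.Zmodule.copy (euclidean R n) 'rV[R]_n.+1.

Definition lebesgue (R : realType) (n : nat) : set (euclidean R n) -> \bar R :=
  @lebesgue_outer R n.

HB.instance Definition _ (R : realType) (n : nat) :=
  isMeasure.Build _ (euclidean R n) R (@lebesgue R n)
    (@caratheodory_measure0 _ _ (@lebesgue_outer R n))
    (@caratheodory_measure_ge0 _ _ (@lebesgue_outer R n))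
    (@caratheodory_measure_sigma_additive _ _ (@lebesgue_outer R n)).

Section nonlocal_perimeter.
Context (R : realType) (n : nat).
Local Notation X := (euclidean R n).
Local Notation mu := (@lebesgue R n).
Implicit Types (K f g : X -> R) (D : set X).

Definition suitable_kernel K :=
  [/\ measurable_fun [set: X] K,
      forall x, (0 <= K x)%R,
      forall x, K (- x)%R = K x
    & \int[mu]_x (K x)%:E = 1].

Definition convolution f g (x : X) : \bar R :=
  \int[mu]_y (f (x - y)%R * g y)%:E.

Definition perimeter K D : \bar R :=
  \int[mu]_(x in ~` D) convolution K \1_D x.

Definition self_interaction K D : \bar R :=
  \int[mu]_(x in D) convolution K \1_D x.

Definition thresholding K D : set X :=
  [set x | (2^-1)%:E < convolution K \1_D x].

End nonlocal_perimeter.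

(* Main.v *)
Require Import Defs.
From HB Require Import structures.
From mathcomp Require Import all_boot all_order all_algebra.
From mathcomp Require Import all_classical all_reals all_analysis.
From mathcomp Require Import measurable_realfun lra.

Import Order.TTheory GRing.Theory Num.Theory.
Import numFieldNormedType.Exports.

(** The proof writes everything in terms of the interaction
    I(A, D) = \int_A K * \chi_D.  It is additive in each argument and, by
    Tonelli's theorem and the evenness of K, symmetric.  Let G be the complement
    of E0 `|` F.  Splitting the complement of E0 into G and F gives
      P(E0) = I(G, E0) + I(F, E0),
      P(E0 `|` F) + S(F) = I(G, E0) + I(G, F) + I(F, F)
                         = I(G, E0) + I(F, ~` E0),
    the last equality by symmetry.  The finite term I(G, E0) cancels, so the
    variational inequality for F says exactly that
      \int_F K * \chi_E0 <= \int_F K * \chi_(~` E0)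
    ([perimeter_variation]).  As K has mass 1 the two convolutions add up to 1,
    so K * \chi_E0 > 1/2 precisely where the first integrand exceeds the second
    ([half_lt_convolution]).  If E1 `\` E0 is null, the inequality between
    the integrands holds almost everywhere on F.  Conversely, taking
    F = E1 `\` E0, the integrals are ordered against integrands which are
    strictly ordered the other way, and all is finite because
    I(F, E0) <= P(E0): F must be null ([measure0_of_le_integral]).

    The real work is the symmetry of I.  Tonelli's theorem holds for the product
    of the two Lebesgue sigma-algebras, but for a K that is only Lebesgue
    measurable the function (x, y) |-> K (y - x) is measurable in general only
    for the completion of that product.  So K is first replaced by a function
    equal to it off a Borel null set N and Borel measurable
    ([measurable_fun_borel_off_null]), for which (x, y) |-> y - x does preserve
    measurability ([measurable_shear]).  The replacement leaves every integral
    of K (y - x) in y, or in x, unchanged, since the translates of N and of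
    its reflection are null ([lebesgue_translate], [lebesgue_reflect_null]);
    this is [convolution_joint_density]. *)

Local Open Scope classical_set_scope.
Local Open Scope ring_scope.
Local Open Scope ereal_scope.

(** * Boxes, coordinates and translations in Euclidean space *)

Section euclidean_sigma_algebra.
Set Implicit Arguments.
Unset Strict Implicit.
Context (R : realType) (n : nat).
Local Notation vec := 'rV[R]_n.+1.
Local Notation X := (euclidean R n).
Local Notation mu := (@lebesgue R n).

Definition coordinate (i : 'I_n.+1) (x : X) : R := (x : vec) ord0 i.

Lemma coordinateB i (x y : X) :
  coordinate i (x - y)%R = (coordinate i x - coordinate i y)%R.
Proof. by rewrite /coordinate !mxE. Qed.

Definition set_coord (v : vec) (i : 'I_n.+1) (t : R) : vec :=
  \row_j (if j == i then t else v ord0 j).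

Lemma max_length_split (a b t : R) :
  (Num.max 0 (b - a) =
    Num.max 0 (Num.min b t - a) + Num.max 0 (b - Num.max a t))%R.
Proof.
case: (leP b t) => bt; case: (leP a t) => ta.
all: do ?[case: (leP 0 _)%R => ?]; lra.
Qed.

(** Cutting a box at height t along axis i affects a single side length, which
    is the sum of the two pieces even when t lies outside the box, because the
    volume truncates negative lengths at 0. *)
Lemma box_volume_split (ab : vec * vec) (i : 'I_n.+1) (t : R) :
  box_volume ab = (box_volume (ab.1, set_coord ab.2 i (Num.min (ab.2 ord0 i) t))
    + box_volume (set_coord ab.1 i (Num.max (ab.1 ord0 i) t), ab.2))%R.
Proof.
have split_i cd : box_volume cd = (Num.max 0 (cd.2 ord0 i - cd.1 ord0 i) *
    \prod_(j < n.+1 | j != i) Num.max 0 (cd.2 ord0 j - cd.1 ord0 j))%R.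
  by rewrite /box_volume (bigD1 i).
rewrite !split_i /= !mxE eqxx.
under [X in (_ = _ * X + _)%R]eq_bigr => j ji do rewrite mxE (negbTE ji).
under [X in (_ = _ + _ * X)%R]eq_bigr => j ji do rewrite mxE (negbTE ji).
rewrite -mulrDl; congr (_ * _)%R; exact: max_length_split.
Qed.

(** A half-space cuts each box of a cover into two boxes of the same total
    volume, so the outer measure is additive across it. *)
Lemma measurable_halfspace (i : 'I_n.+1) (t : R) :
  measurable [set x : X | (coordinate i x <= t)%R].
Proof.
apply: le_caratheodory_measurable => A /=.
apply: le_ereal_inf_tmp => _ [B AB <-].
pose B1 k := ((B k).1, set_coord (B k).2 i (Num.min ((B k).2 ord0 i) t)).
pose B2 k := (set_coord (B k).1 i (Num.max ((B k).1 ord0 i) t), (B k).2).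
have -> : \sum_(k <oo) (box_volume (B k))%:E =
    \sum_(k <oo) (box_volume (B1 k))%:E + \sum_(k <oo) (box_volume (B2 k))%:E.
  rewrite -nneseriesD//; [|by move=> *; exact: box_volume_ge0..].
  by apply: eq_eseriesr => k _; rewrite -EFinD -box_volume_split.
apply: leeD; apply: ereal_inf_lbound => /=.
- exists B1 => // x [Ax xt]; have [k _ Bx] := AB _ Ax.
  exists k => // j; have := Bx j; rewrite /B1 /= mxE.
  by case: eqP => // ->; rewrite le_min => /andP[-> ->].
- exists B2 => // x [Ax /negP]; rewrite -ltNge => xt; have [k _ Bx] := AB _ Ax.
  exists k => // j; have := Bx j; rewrite /B2 /= mxE.
  by case: eqP => // ->; rewrite gt_max => /andP[-> ->]; rewrite xt.
Qed.

Lemma measurable_coordinate (i : 'I_n.+1) :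
  measurable_fun [set: X] (coordinate i).
Proof.
apply: (measurability _ (RGenOInfty.measurableE R)) => _ [_ [t ->] <-].
rewrite setTI (_ : _ @^-1` _ = ~` [set x | (coordinate i x <= t)%R]).
  exact/measurableC/measurable_halfspace.
by apply/seteqP; split => x /=; rewrite in_itv /= andbT ltNge => /negP.
Qed.

Local Notation boxes := (range (@box R n)).
Local Notation B := (g_sigma_algebraType boxes).

(** The preimage of a box is a finite intersection of conditions on single
    coordinates. *)
Lemma measurable_fun_borel d (T : measurableType d) (f : T -> vec) :
  (forall i, measurable_fun [set: T] (fun t => f t ord0 i)) ->
  measurable_fun [set: T] (f : T -> B).
Proof.
move=> mf.
apply: (@measurability _ _ T B setT f boxes) => // _ [_ [ab _ <-] <-].
rewrite setTI (_ : _ @^-1` _ = \bigcap_(i in [set: 'I_n.+1])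
    (fun t => f t ord0 i) @^-1` `](ab.1 ord0 i), (ab.2 ord0 i)]).
  apply: fin_bigcap_measurable => // i _.
  by rewrite -[_ @^-1` _]setTI; exact: mf.
apply/seteqP; split => [t ft i _|t ft i] /=.
  by rewrite in_itv /=; exact: ft.
by have /= := ft i Logic.I; rewrite in_itv.
Qed.

Lemma measurable_borel_id : measurable_fun [set: X] (idfun : X -> B).
Proof. by apply: measurable_fun_borel => i; exact: measurable_coordinate. Qed.

Lemma measurable_borel (A : set X) :
  boxes.-sigma.-measurable (A : set B) -> measurable A.
Proof.
by move=> mA; have := measurable_borel_id measurableT mA; rewrite setTI.
Qed.

Lemma lebesgue_translate_le (a : X) (A : set X) :
  mu ((fun y => y - a)%R @^-1` A) <= mu A.
Proof.
apply: le_ereal_inf_tmp => _ [C AC <-].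
apply: ereal_inf_lbound.
exists (fun k => ((C k).1 + a, (C k).2 + a)%R).
  move=> x /= /AC [k _ Cx]; exists k => // i; have := Cx i.
  by rewrite /= !mxE ltrBrDr lerBlDr.
apply: eq_eseriesr => k _; congr EFin; apply: eq_bigr => i _.
by rewrite /= !mxE opprD addrACA subrr addr0.
Qed.

Lemma lebesgue_translate (a : X) (A : set X) :
  mu ((fun y => y - a)%R @^-1` A) = mu A.
Proof.
apply/eqP; rewrite eq_le lebesgue_translate_le /=.
rewrite -{1}[A](_ :
  (fun y => y - - a)%R @^-1` ((fun y => y - a)%R @^-1` A) = A).
  exact: lebesgue_translate_le.
by apply/seteqP; split => x /=; rewrite opprK addrK.
Qed.

(** Translating the test set back turns Caratheodory's criterion for the
    translated set into the criterion for the set itself. *)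
Lemma measurable_translate (a : X) :
  measurable_fun [set: X] (fun y : X => y - a)%R.
Proof.
move=> _ A mA; rewrite setTI.
change (mu.-caratheodory ((fun y : X => y - a)%R @^-1` A)); move=> Y.
pose s : set X := (fun y => y - - a)%R @^-1` Y.
have tr (Z : set X) :
    (fun y => y - - a)%R @^-1` (Y `&` (fun y => y - a)%R @^-1` Z) = s `&` Z.
  by apply/seteqP; split => x; rewrite /s /= opprK addrK.
rewrite -[LHS](lebesgue_translate (- a)%R).
rewrite -[X in X + _](lebesgue_translate (- a)%R).
rewrite -[X in _ + X](lebesgue_translate (- a)%R).
by rewrite (tr A) (tr (~` A)); exact: mA.
Qed.

Lemma lebesgue_box_le ab : mu (box ab) <= (box_volume ab)%:E.
Proof.
apply: ereal_inf_lbound.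
exists (fun k : nat => if k == 0%N then ab else (0, 0)%R).
  by move=> x xab; exists 0%N.
rewrite nneseries_recl//; last by move=> *; exact: box_volume_ge0.
rewrite eseries_cond/= eseries0 ?adde0// => -[|]//= k _ _.
by rewrite /box_volume big_ord_recl/= subrr maxxx mul0r.
Qed.

Lemma measurable_box ab : measurable (box ab : set X).
Proof. by apply: measurable_borel; apply: sub_sigma_algebra; exists ab. Qed.

Definition cube (k : nat) : set X := box (const_mx (- k%:R), const_mx k%:R)%R.

Lemma bigcup_cube : \bigcup_k cube k = [set: X].
Proof.
apply/seteqP; split => // x _.
pose r := (\sum_i `|coordinate i x|)%R.
exists (Num.truncn r).+1 => // i; rewrite /= !mxE.
have xr : (`|coordinate i x| <= r)%R.
  by rewrite /r (bigD1 i)//= lerDl sumr_ge0.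
have := truncnS_gt r => rk.
have := le_lt_trans xr rk; rewrite ltr_norml => /andP[-> /ltW]; exact.
Qed.

Lemma lebesgue_sigma_finite : sigma_finite [set: X] mu.
Proof.
exists cube; first by rewrite bigcup_cube.
move=> k; split; first exact: measurable_box.
by rewrite (le_lt_trans (lebesgue_box_le _))// ltry.
Qed.

HB.instance Definition _ :=
  @Measure_isSigmaFinite.Build _ X R mu lebesgue_sigma_finite.

End euclidean_sigma_algebra.

(** * Borel sets and functions up to null sets *)

Section borel_hull.
Set Implicit Arguments.
Unset Strict Implicit.
Context (R : realType) (n : nat).
Local Notation X := (euclidean R n).
Local Notation mu := (@lebesgue R n).
Local Notation boxes := (range (@box R n)).
Local Notation B := (g_sigma_algebraType boxes).

Lemma borel_cover (A : set X) (e : R) : (0 < e)%R -> mu A < +oo ->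
  exists U : set B, [/\ measurable U, A `<=` U & mu U <= mu A + e%:E].
Proof.
move=> e0 Aoo.
have fA : mu A \is a fin_num by rewrite ge0_fin_numE.
have [_ [C AC <-] /ltW leC] := lb_ereal_inf_adherent e0 fA.
exists (\bigcup_k box (C k)); split => //.
  by apply: bigcupT_measurable => k; apply: sub_sigma_algebra; exists (C k).
by apply: le_trans leC; apply: ereal_inf_lbound; exists C.
Qed.

(** The hull is an intersection of countable unions of boxes, namely covers
    of A whose total volumes tend to the measure of A. *)
Lemma borel_hull_lty (A : set X) : measurable A -> mu A < +oo ->
  exists U : set B, [/\ measurable U, A `<=` U & mu (U `\` A) = 0].
Proof.
move=> mA Aoo.
have [U HU] : {U : (set B)^nat & forall k,
    [/\ measurable (U k), A `<=` U k & mu (U k) <= mu A + k.+1%:R^-1%:E]}.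
  by apply: (@choice _ _ (fun k (V : set B) => [/\ measurable V, A `<=` V &
    mu V <= mu A + k.+1%:R^-1%:E])) => k; exact: borel_cover.
exists (\bigcap_k U k).
have mU : measurable (\bigcap_k U k : set B).
  by apply: bigcapT_measurable => k; have [] := HU k.
have AU : A `<=` \bigcap_k U k by move=> x Ax k _; have [_ + _] := HU k; exact.
split => //.
have leU : mu (\bigcap_k U k) <= mu A.
  apply/lee_addgt0Pr => e e0.
  have [k ke] : exists k : nat, (k.+1%:R^-1 < e)%R.
    exists (Num.truncn e^-1); rewrite invf_plt ?posrE//.
    by rewrite truncnS_gt.
  have [_ _ /le_trans leUk] := HU k.
  apply: (@le_trans _ _ (mu (U k))).
    by apply: le_lebesgue_outer => x; exact.
  by apply: leUk; rewrite leeD2l// lee_fin ltW.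
rewrite measureD//; [|exact: measurable_borel|exact: le_lt_trans Aoo].
rewrite setIidr//.
apply/eqP; rewrite eq_le sube_le0 leU sube_ge0 ?ge0_fin_numE//.
  by rewrite le_lebesgue_outer.
by rewrite Aoo.
Qed.

(** Finiteness of the measure is removed by hulling the pieces of A inside an
    exhausting sequence of cubes. *)
Lemma borel_hull (A : set X) : measurable A ->
  exists U : set B, [/\ measurable U, A `<=` U & mu (U `\` A) = 0].
Proof.
move=> mA.
have mAk k : measurable (A `&` @cube R n k).
  by apply: measurableI => //; exact: measurable_box.
have Akoo k : mu (A `&` @cube R n k) < +oo.
  apply: (@le_lt_trans _ _ (mu (@cube R n k))); first exact: le_lebesgue_outer.
  by rewrite (le_lt_trans (lebesgue_box_le _))// ltry.
have [U HU] : {U : (set B)^nat & forall k,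
    [/\ measurable (U k), A `&` @cube R n k `<=` U k &
        mu (U k `\` (A `&` @cube R n k)) = 0]}.
  by apply: (@choice _ _ (fun k (V : set B) => [/\ measurable V,
    A `&` @cube R n k `<=` V & mu (V `\` (A `&` @cube R n k)) = 0])) => k;
    exact: borel_hull_lty.
have mU k : measurable (U k) by have [] := HU k.
exists (\bigcup_k U k); split.
- exact: bigcupT_measurable.
- move=> x Ax; have : [set: X] x by [].
  rewrite -bigcup_cube => -[k _ xk]; exists k => //.
  by have [_ + _] := HU k; exact.
- apply: (@subset_measure0 _ _ _ mu _
    (\bigcup_k (U k `\` (A `&` @cube R n k)))).
  + apply: measurableD => //; apply: bigcupT_measurable => k.
    exact: measurable_borel.
  + apply: bigcupT_measurable => k; apply: measurableD => //.
    exact: measurable_borel.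
  + by move=> x [[k _ Ux] Ax]; exists k => //; split => // -[].
  + apply/negligibleP; last apply: negligible_bigcup => k.
      apply: bigcupT_measurable => k; apply: measurableD => //.
      exact: measurable_borel.
    have [_ _ U0] := HU k; apply/negligibleP => //.
    by apply: measurableD => //; exact: measurable_borel.
Qed.

(** N is a Borel null set that contains, for every rational q, the difference
    between [set x | q < f x] and a Borel hull H of it.  Off N the two sets
    coincide, and countably many rational levels determine f. *)
Lemma measurable_fun_borel_off_null (f : X -> R) : measurable_fun [set: X] f ->
  exists N : set B, [/\ measurable N, mu N = 0 &
    measurable_fun (~` N) (f : B -> R)].
Proof.
move=> mf.
(* an enumeration of the rationals; numbers that code nothing give 0 *)
pose q k : R := ratr (odflt 0%R (unpickle k) : rat).
pose C k : set X := f @^-1` `]q k, +oo[.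
have mC k : measurable (C k) by rewrite /C -[_ @^-1` _]setTI; exact: mf.
have [H HC] : {H : (set B)^nat & forall k,
    [/\ measurable (H k), C k `<=` H k & mu (H k `\` C k) = 0]}.
  by apply: (@choice _ _ (fun k (V : set B) => [/\ measurable V, C k `<=` V &
    mu (V `\` C k) = 0])) => k; exact: borel_hull.
have mHC k : measurable (H k `\` C k : set X).
  by apply: measurableD => //; apply: measurable_borel; have [] := HC k.
pose N0 : set X := \bigcup_k (H k `\` C k).
have mN0 : measurable N0 by exact: bigcupT_measurable.
have N00 : mu N0 = 0.
  apply/negligibleP => //; apply: negligible_bigcup => k.
  by apply/negligibleP => //; have [] := HC k.
have [N [mN N0N NN0]] := borel_hull mN0.
exists N; split => //.
  apply/eqP; rewrite eq_le measure_ge0 andbT.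
  rewrite -[X in mu X](setDUK N0N).
  have mNN0 : measurable (N `\` N0 : set X).
    by apply: measurableD => //; exact: measurable_borel.
  rewrite (le_trans (measureU2 mu mN0 mNN0))//.
  by rewrite [X in X + _]N00 add0e [leLHS]NN0.
apply: (measurability _ (RGenOInfty.measurableE R)) => _ [_ [t ->] <-].
rewrite (_ : _ `&` _ = ~` N `&` \bigcup_(k in [set k | (t < q k)%R]) H k).
  apply: measurableI; first exact: measurableC.
  by apply: bigcup_measurable => k _; have [] := HC k.
apply/seteqP; split => x [Nx /=].
  rewrite in_itv/= andbT => tf; split => //.
  have [r] := rat_in_itvoo tf; rewrite in_itv/= => /andP[tr rf].
  exists (pickle r); first by rewrite /q /= pickleK.
  have [_ + _] := HC (pickle r); apply.
  by rewrite /C /q /= pickleK /= in_itv/= rf.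
move=> [k /= tk Hx]; split => //; rewrite in_itv/= andbT (lt_trans tk)//.
have [|] := pselect (C k x); first by rewrite /C /= in_itv/= andbT.
by move=> Cx; exfalso; apply: Nx; apply: N0N; exists k.
Qed.

End borel_hull.

(** * The convolution kernel on the product space *)

Section convolution.
Set Implicit Arguments.
Unset Strict Implicit.
Context (R : realType) (n : nat).
Local Notation X := (euclidean R n).
Local Notation mu := (@lebesgue R n).
Local Notation boxes := (range (@box R n)).
Local Notation B := (g_sigma_algebraType boxes).
Implicit Types (K : X -> R) (A D : set X).

Lemma measurable_shear :
  measurable_fun [set: X * X] ((fun p => p.2 - p.1)%R : X * X -> B).
Proof.
apply: measurable_fun_borel => i.
under eq_fun => p do rewrite -/(coordinate i (p.2 - p.1)%R) coordinateB.
by apply: measurable_funB; apply: measurableT_comp => //;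
  exact: measurable_coordinate.
Qed.

Lemma measurable_reflect (y : X) :
  measurable_fun [set: X] ((fun x => y - x)%R : X -> B).
Proof.
apply: measurable_fun_borel => i.
under eq_fun => x do rewrite -/(coordinate i (y - x)%R) coordinateB.
by apply: measurable_funB => //; exact: measurable_coordinate.
Qed.

(** Reflection moves the closed faces of a half-open box to the other side, so
    covers cannot simply be reflected; Tonelli's theorem is used instead.  For
    each x the points z with z - x in N form a null set; for each z the points
    x with z - x in N form a set whose measure c does not depend on z, by
    translation.  Thus c * mu setT = 0, which forces c = 0 as c <= mu setT. *)
Lemma lebesgue_reflect_null (N : set X) (y : X) :
  boxes.-sigma.-measurable N -> mu N = 0 ->
  mu ((fun x => y - x)%R @^-1` N) = 0.
Proof.
move=> mN N0.
have translN z : (fun x => z - x)%R @^-1` N =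
    (fun x => x - z)%R @^-1` ((fun x => 0 - x)%R @^-1` N).
  by apply/seteqP; split => x /=; rewrite sub0r opprB.
rewrite translN lebesgue_translate; set c := mu _.
pose S : set (X * X) := (fun p => p.2 - p.1)%R @^-1` N.
have mS : measurable S by rewrite /S -[_ @^-1` _]setTI; exact: measurable_shear.
pose h (p : X * X) : \bar R := (\1_S p)%:E.
have mh : measurable_fun [set: X * X] h.
  by apply/measurable_EFinP; exact: measurable_indic.
have h0 p : 0 <= h p by rewrite lee_fin.
have mS1 x : measurable (xsection S x) by exact: measurable_xsection.
have mS2 z : measurable (ysection S z) by exact: measurable_ysection.
have F0 x : \int[mu]_z h (x, z) = 0.
  rewrite [LHS](_ : _ = \int[mu]_z (\1_(xsection S x) z)%:E); last first.
    by apply: eq_integral => z _; rewrite !indicE mem_xsection.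
  rewrite integral_indic// setIT -[RHS]N0 -(lebesgue_translate x N).
  by congr (mu _); apply/seteqP; split => z; rewrite /xsection /= inE.
have Gc z : \int[mu]_x h (x, z) = c.
  rewrite [LHS](_ : _ = \int[mu]_x (\1_(ysection S z) x)%:E); last first.
    by apply: eq_integral => x _; rewrite !indicE mem_ysection.
  rewrite integral_indic// setIT /c -(lebesgue_translate z) -translN.
  by congr (mu _); apply/seteqP; split => x; rewrite /ysection /= inE.
have : \int[mu]_x \int[mu]_z h (x, z) = \int[mu]_z \int[mu]_x h (x, z).
  exact: (fubini_tonelli (m1 := mu) (m2 := mu) h mh h0).
under eq_integral => x _ do rewrite F0.
under [RHS]eq_integral => z _ do rewrite Gc.
rewrite integral0 integral_cst// => /esym/eqP; rewrite mule_eq0.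
case/orP => [/eqP//|/eqP T0].
apply/eqP; rewrite eq_le measure_ge0 andbT -[leRHS]T0.
exact: le_lebesgue_outer.
Qed.

Lemma convolution_indicE K D x :
  convolution K \1_D x = \int[mu]_(y in D) (K (x - y)%R)%:E.
Proof.
rewrite [RHS]integral_mkcond epatch_indic.
by apply: eq_integral => y _; rewrite /= EFinM.
Qed.

Lemma measurable_kernel_translate K x : measurable_fun [set: X] K ->
  measurable_fun [set: X] (fun y => (K (y - x)%R)%:E).
Proof.
move=> mK; apply/measurable_EFinP.
by apply: (measurableT_comp mK); exact: measurable_translate.
Qed.

(** The last two clauses represent the same convolution by integrating k in its
    second and in its first variable: this carries the evenness of K over to k,
    which itself need not be symmetric. *)
Lemma convolution_joint_density K : measurable_fun [set: X] K ->
  (forall x, (0 <= K x)%R) -> (forall x, K (- x)%R = K x) ->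
  exists k : X * X -> \bar R, [/\ measurable_fun [set: X * X] k,
    forall p, 0 <= k p,
    forall D x, measurable D ->
      convolution K \1_D x = \int[mu]_(y in D) k (x, y) &
    forall D y, measurable D ->
      convolution K \1_D y = \int[mu]_(x in D) k (x, y)].
Proof.
move=> mK K0 KN.
have KB x y : K (x - y)%R = K (y - x)%R by rewrite -KN opprB.
have [N [mN N0 mKN]] := measurable_fun_borel_off_null mK.
have mKb : measurable_fun [set: B] (K \_ (~` N) : B -> R).
  apply/(measurable_restrictT _ _).1 => //; exact: measurableC.
pose k (p : X * X) := ((K \_ (~` N)) (p.2 - p.1)%R)%:E.
have mk : measurable_fun [set: X * X] k.
  apply/measurable_EFinP; apply: (measurableT_comp mKb).
  exact: measurable_shear.
have k0 p : 0 <= k p by rewrite lee_fin /patch; case: ifP.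
have mN' : measurable (N : set X) by exact: measurable_borel.
have kE x y : ~ N (y - x)%R -> k (x, y) = (K (y - x)%R)%:E.
  by move=> Nyx; rewrite /k patchE mem_set.
exists k; split => // D.
- move=> x mD; rewrite convolution_indicE.
  apply: ge0_ae_eq_integral => //.
  + under eq_fun => y do rewrite KB.
    exact/measurable_funTS/measurable_kernel_translate.
  + apply: measurable_funTS; exact: (measurableT_comp mk (pair1_measurable x)).
  + by move=> y _; rewrite lee_fin.
  + exists ((fun y => y - x)%R @^-1` N); split.
    * by rewrite -[_ @^-1` _]setTI; exact: measurable_translate.
    * by rewrite [LHS]lebesgue_translate.
    * move=> y /=; apply: contra_notP => Nyx _.
      by rewrite kE// KB.
- move=> y mD; rewrite convolution_indicE.
  apply: ge0_ae_eq_integral => //.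
  + under eq_fun => x do rewrite KB.
    exact/measurable_funTS/measurable_kernel_translate.
  + apply: measurable_funTS; exact: (measurableT_comp mk (pair2_measurable y)).
  + by move=> x _; rewrite lee_fin.
  + exists ((fun x => y - x)%R @^-1` N); split.
    * by rewrite -[_ @^-1` _]setTI; exact: measurable_reflect.
    * exact: lebesgue_reflect_null.
    * by move=> x /=; apply: contra_notP => Nyx _; rewrite kE.
Qed.

End convolution.

(** * A criterion for null sets *)

(** The finite quantity \int_F f cancels, so g - f > 0 has integral at most 0
    on F. *)
Lemma measure0_of_le_integral d (T : measurableType d) (R : realType)
    (mu : {measure set T -> \bar R}) (F : set T) (f g : T -> \bar R) :
  measurable F -> measurable_fun F f -> measurable_fun F g ->
  (forall x, F x -> 0 <= f x) -> (forall x, F x -> f x < g x) ->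
  \int[mu]_(x in F) g x < +oo ->
  \int[mu]_(x in F) g x <= \int[mu]_(x in F) f x -> mu F = 0.
Proof.
move=> mF mf mg f0 fg goo gf.
have ffin x : F x -> f x \is a fin_num.
  by move=> Fx; rewrite ge0_fin_numE ?f0// (lt_le_trans (fg _ Fx))// leey.
have mgf : measurable_fun F (g \- f) by exact: emeasurable_funB.
have gf0 x : F x -> 0 <= (g \- f) x.
  by move=> Fx /=; rewrite sube_ge0 ?ffin// ltW ?fg.
have split_g : \int[mu]_(x in F) g x =
    \int[mu]_(x in F) f x + \int[mu]_(x in F) (g \- f) x.
  rewrite -ge0_integralD//; apply: eq_integral => x; rewrite inE => Fx.
  by rewrite /= addeC subeK// ffin.
have int0 : \int[mu]_(x in F) (g \- f) x = 0.
  apply/eqP; rewrite eq_le integral_ge0// andbT.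
  have fint : \int[mu]_(x in F) f x \is a fin_num.
    rewrite ge0_fin_numE ?integral_ge0//; apply: le_lt_trans goo.
    by apply: ge0_le_integral => // x Fx; exact/ltW/fg.
  by move: gf; rewrite split_g -[leRHS]adde0 leeD2lE.
have : \int[mu]_(x in F) `|(g \- f) x| = 0.
  rewrite -int0; apply: eq_integral => x; rewrite inE => Fx.
  by rewrite gee0_abs// gf0.
move/(ae_eq_integral_abs mu mF mgf) => ae0.
apply/negligibleP => //; apply: negligibleS ae0 => x Fx /= /(_ Fx) gf0x.
by have := fg x Fx; rewrite -sube_gt0 gf0x ltxx.
Qed.

(** * Interaction of two sets *)

Section interaction.
Set Implicit Arguments.
Unset Strict Implicit.
Context (R : realType) (n : nat) (K : euclidean R n -> R).
Context (kerK : suitable_kernel K).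
Local Notation X := (euclidean R n).
Local Notation mu := (@lebesgue R n).
Implicit Types (A D F : set X).

Definition interaction A D : \bar R := \int[mu]_(x in A) convolution K \1_D x.

Let mK : measurable_fun [set: X] K. Proof. by case: kerK. Qed.
Let K0 x : (0 <= K x)%R. Proof. by case: kerK. Qed.
Let KN x : K (- x)%R = K x. Proof. by case: kerK. Qed.

Lemma convolution_ge0 D x : 0 <= convolution K \1_D x.
Proof.
by rewrite convolution_indicE integral_ge0// => y _; rewrite lee_fin.
Qed.

Lemma measurable_convolution D : measurable D ->
  measurable_fun [set: X] (convolution K \1_D).
Proof.
move=> mD; have [k [mk k0 kE _]] := convolution_joint_density mK K0 KN.
pose h (p : X * X) : \bar R := k p * (\1_D p.2)%:E.
have mh : measurable_fun [set: X * X] h.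
  apply: emeasurable_funM => //; apply/measurable_EFinP.
  exact: (measurableT_comp (measurable_indic _) measurable_snd).
have h0 p : 0 <= h p by rewrite mule_ge0// lee_fin.
rewrite (_ : convolution K _ = fubini_F mu h).
  exact: measurable_fun_fubini_tonelli_F.
apply/funext => x; rewrite kE// [LHS]integral_mkcond epatch_indic.
exact: eq_integral.
Qed.

Lemma convolutionU D F x : measurable D -> measurable F -> [disjoint D & F] ->
  convolution K \1_(D `|` F) x = convolution K \1_D x + convolution K \1_F x.
Proof.
move=> mD mF DF; have [k [mk k0 kE _]] := convolution_joint_density mK K0 KN.
rewrite !kE//; last exact: measurableU.
rewrite ge0_integral_setU//.
apply: measurable_funTS; exact: (measurableT_comp mk (pair1_measurable x)).
Qed.

(** By evenness the integrand y |-> K (x - y) is a translate of K, so its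
    integral is that of K. *)
Lemma convolution_indicT x : convolution K \1_[set: X] x = 1.
Proof.
have [_ _ _ <-] := kerK; rewrite convolution_indicE.
have KB y : (K (x - y))%:E = (EFin \o K) (y - x)%R.
  by rewrite /= -KN opprB.
under eq_integral => y _ do rewrite KB.
have mt := measurable_translate x.
have mEK : measurable_fun [set: X] (EFin \o K) by exact/measurable_EFinP.
rewrite -[LHS](@ge0_integral_pushforward _ _ _ _ _ _ mt mu setT (EFin \o K))//.
  by apply: eq_measure_integral => A mA _; exact: lebesgue_translate.
by move=> y _; rewrite /= lee_fin.
Qed.

Lemma interactionUl A A' D : measurable A -> measurable A' -> measurable D ->
  [disjoint A & A'] ->
  interaction (A `|` A') D = interaction A D + interaction A' D.
Proof.
move=> mA mA' mD AA'; apply: ge0_integral_setU => //.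
- exact/measurable_funTS/measurable_convolution.
- by move=> x _; exact: convolution_ge0.
Qed.

Lemma interactionUr A D F : measurable A -> measurable D -> measurable F ->
  [disjoint D & F] ->
  interaction A (D `|` F) = interaction A D + interaction A F.
Proof.
move=> mA mD mF DF; rewrite /interaction.
under eq_integral => x _ do rewrite convolutionU//.
rewrite ge0_integralD//.
- by move=> x _; exact: convolution_ge0.
- exact/measurable_funTS/measurable_convolution.
- by move=> x _; exact: convolution_ge0.
- exact/measurable_funTS/measurable_convolution.
Qed.

(** Tonelli's theorem for the joint density k, extended by 0 outside of
    A `*` D. *)
Lemma interactionC A D : measurable A -> measurable D ->
  interaction A D = interaction D A.
Proof.
move=> mA mD; have [k [mk k0 kl kr]] := convolution_joint_density mK K0 KN.
rewrite /interaction.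
under eq_integral => x _ do rewrite kl//.
under [RHS]eq_integral => y _ do rewrite kr//.
pose h := k \_ (A `*` D).
have mh : measurable_fun [set: X * X] h.
  apply/(measurable_restrictT _ _).1; first exact: measurableX.
  exact: measurable_funTS.
have h0 p : 0 <= h p by rewrite /h patchE; case: ifP.
have hl : \int[mu]_x \int[mu]_y h (x, y) =
    \int[mu]_(x in A) \int[mu]_(y in D) k (x, y).
  rewrite [RHS]integral_mkcond; apply: eq_integral => x _; rewrite patchE.
  case: ifPn => xA; last first.
    by apply: integral0_eq => y _; rewrite /h patchE in_setX (negbTE xA).
  rewrite [RHS]integral_mkcond; apply: eq_integral => y _.
  by rewrite /h !patchE in_setX xA.
have hr : \int[mu]_y \int[mu]_x h (x, y) =
    \int[mu]_(y in D) \int[mu]_(x in A) k (x, y).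
  rewrite [RHS]integral_mkcond; apply: eq_integral => y _; rewrite patchE.
  case: ifPn => yD; last first.
    by apply: integral0_eq => x _; rewrite /h patchE in_setX (negbTE yD) andbF.
  rewrite [RHS]integral_mkcond; apply: eq_integral => x _.
  by rewrite /h !patchE in_setX yD andbT.
rewrite -hl -hr.
exact: (fubini_tonelli (m1 := mu) (m2 := mu) h mh h0).
Qed.

End interaction.

(** * Variation of the perimeter *)

Section variation.
Set Implicit Arguments.
Unset Strict Implicit.
Context (R : realType) (n : nat) (K : euclidean R n -> R).
Context (kerK : suitable_kernel K).
Local Notation X := (euclidean R n).
Local Notation mu := (@lebesgue R n).
Implicit Types (A D F : set X).

Lemma convolution_setC D x : measurable D ->
  convolution K \1_D x + convolution K \1_(~` D) x = 1.
Proof.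
move=> mD; rewrite -convolutionU//; first by rewrite setUv convolution_indicT.
- exact: measurableC.
- by apply/disj_setPS => y [].
Qed.

Lemma half_lt_convolution D x : measurable D ->
  (2^-1%:E < convolution K \1_D x) =
  (convolution K \1_(~` D) x < convolution K \1_D x).
Proof.
move=> mD; have := convolution_setC x mD.
have := convolution_ge0 kerK D x; have := convolution_ge0 kerK (~` D) x.
case: (convolution K \1_(~` D) x) => [b| |];
  case: (convolution K \1_D x) => [a| |] //=.
rewrite !lee_fin -EFinD => b0 a0 [ab1]; rewrite !lte_fin.
by apply/idP/idP; lra.
Qed.

(** Both sides of the variational inequality contain the interaction of D with
    the set G outside of D and F; it is finite since it is part of P(D). *)
Lemma perimeter_variation D F : measurable D -> measurable F -> F `<=` ~` D ->
  perimeter K D < +oo ->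
  (perimeter K D <= perimeter K (D `|` F) + self_interaction K F) =
  (interaction K F D <= interaction K F (~` D)).
Proof.
move=> mD mF FD Poo; pose G := ~` (D `|` F).
have mDc : measurable (~` D) by exact: measurableC.
have mDF : measurable (D `|` F) by exact: measurableU.
have mG : measurable G by exact: measurableC.
have GF : ~` D = G `|` F.
  by rewrite /G setCU setUIl setUCl setIT; apply/esym/setUidl.
have dGF : [disjoint G & F].
  by apply/disj_setPS => x [GFx Fx]; apply: GFx; right.
have dDF : [disjoint D & F] by apply/disj_setPS => x [Dx /FD].
have PD : perimeter K D = interaction K G D + interaction K F D.
  by rewrite -(interactionUl kerK mG mF mD dGF) -GF.
have PDF : perimeter K (D `|` F) + self_interaction K F =
    interaction K G D + interaction K F (~` D).
  transitivity (interaction K G D + interaction K G F + interaction K F F).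
    by congr (_ + _); exact: (interactionUr kerK mG mD mF dDF).
  rewrite -addeA; congr (_ + _).
  by rewrite (interactionC kerK mF mDc) GF (interactionUl kerK mG mF mF dGF).
have GD : interaction K G D \is a fin_num.
  rewrite ge0_fin_numE; last first.
    by apply: integral_ge0 => x _; exact: convolution_ge0.
  apply: le_lt_trans Poo; rewrite PD leeDl//.
  by apply: integral_ge0 => x _; exact: convolution_ge0.
by rewrite PD PDF leeD2lE.
Qed.

End variation.

Theorem theorem3p3 (R : realType) (n : nat) (K : euclidean R n -> R)
    (E0 Omega : set (euclidean R n)) :
  suitable_kernel K ->
  measurable E0 -> measurable Omega -> E0 `<=` Omega ->
  perimeter K E0 < +oo ->
  let E1 := thresholding K E0 in
  E1 `|` E0 `<=` Omega ->
  lebesgue (E1 `\` E0) = 0 <->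
  (forall F : set (euclidean R n), measurable F -> F `<=` Omega `\` E0 ->
    perimeter K E0 <= perimeter K (E0 `|` F) + self_interaction K F).
Proof.
move=> kerK mE0 _ _ Poo E1 E1Omega.
have mc D : measurable D -> forall A, measurable_fun A (convolution K \1_D).
  by move=> mD A; exact/measurable_funTS/measurable_convolution.
have mE0c := measurableC mE0.
have cge0 := convolution_ge0 kerK.
have mE1 : measurable E1.
  by rewrite -[E1]setTI; exact: emeasurable_fun_o_infty (mc _ mE0 setT) _.
split=> [E10 F mF FOmega|le_perimeter].
  have FE0 : F `<=` ~` E0 by move=> x /FOmega[].
  rewrite perimeter_variation//.
  apply: ae_ge0_le_integral => //; [exact: mc|exact: mc|].
  exists (E1 `\` E0); split => //; first exact: measurableD.
  move=> x /= /not_implyP[Fx /negP].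
  rewrite -ltNge -half_lt_convolution// => E1x.
  by split => //; exact: FE0.
pose F := E1 `\` E0.
have mF : measurable F by exact: measurableD.
have FE0 : F `<=` ~` E0 by move=> x [].
have FOmega : F `<=` Omega `\` E0.
  by move=> x [E1x E0x]; split => //; apply: E1Omega; left.
(* F is exactly the part of the complement of E0 where K * \chi_E0 is larger
   than K * \chi_(~` E0), so any violation of the inequality shows up here *)
have := le_perimeter F mF FOmega; rewrite perimeter_variation// => leF.
apply: (@measure0_of_le_integral _ _ _ (@lebesgue R n) F
  (convolution K \1_(~` E0)) (convolution K \1_E0)) => //;
  [exact: mc|exact: mc| |].
  by move=> x [E1x _]; rewrite -half_lt_convolution.
apply: le_lt_trans Poo; apply: ge0_subset_integral => //; exact: mc.
Qed.
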